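(* Let $0<p<1$ be fixed and let $b=1/(1-p)$. Then almost surely $$h_f(G(n,p))=(1+o(1))\frac{n}{\sqrt{\log_b n}};$$ that is, for every fixed $\delta>0$, the probability that $(1-\delta)\frac{n}{\sqrt{\log_b n}}\le h_f(G(n,p))\le (1+\delta)\frac{n}{\sqrt{\log_b n}}$ tends to $1$ as $n\to\infty$. In particular, the fractional Hadwiger number of $G(n,p)$ is almost surely asymptotically equal to its Hadwiger number.
   Context: $G(n,p)$ denotes the random graph on $n$ vertices in which each pair of vertices is an edge independently with probability $p$; ''almost surely'' means with probability tending to $1$ as $n\to\infty$. For a graph $G$, the Hadwiger number $h(G)$ is the largest $t$ such that $K_t$ is a minor of $G$. A bramble for $G$ is a collection $\mathcal B$ of connected subgraphs of $G$ such that every pair $B,B'\in\mathcal B$ either shares a vertex or is joined by an edge of $G$. The fractional Hadwiger number $h_f(G)$ is the maximum of $\sum_{B\in\mathcal B} w(B)$ over all brambles $\mathcal B$ for $G$ and all $w:\mathcal B\to\mathbb R_{\ge0}$ such that for every vertex $v$, the sum of $w(B)$ over $B\in\mathcal B$ containing $v$ is at most $1$. (It is known, due to Bollobás, Catlin and Erdős, that almost surely $h(G(n,p))=(1+o(1))n/\sqrt{\log_b n}$.) *)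

(* Defs.v *)
From HB Require Import structures.
From mathcomp Require Import all_boot all_order all_algebra.
From mathcomp Require Import all_classical all_reals all_analysis.

Set Implicit Arguments.
Unset Strict Implicit.
Unset Printing Implicit Defensive.

Import Order.TTheory GRing.Theory Num.Theory.
Import numFieldNormedType.Exports.

Local Open Scope ring_scope.

Definition pairs (V : finType) : {set {set V}} :=
  [set e : {set V} | #|e| == 2]%SET.

(* A simple graph whose vertex set is all of V, given by its set of edges.    *)
Record sgraph (V : finType) := SGraph {
  edges : {set {set V}};
  edges_pairs : edges \subset pairs V }.

HB.instance Definition _ (V : finType) := [isSub for @edges V].
HB.instance Definition _ (V : finType) := [Finite of sgraph V by <:].

Definition complete_graph (t : nat) : sgraph 'I_t := SGraph (subxx (pairs 'I_t)).

Section GraphNotions.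
Variable V : finType.
Implicit Types (G : sgraph V) (S : {set V}) (F : {set {set V}}).

(* [set x; x] has one element, so adj G is irreflexive.                       *)
Definition adj G : rel V := fun x y => [set x; y]%SET \in edges G.

(* Connectedness of the graph with vertex set S and edge set F, where every   *)
(* member of F is a subset of S; as usual the empty graph is not connected.   *)
Definition connected_graph S F : bool :=
  (S != finset.set0) &&
  [forall x in S, forall y in S,
     fingraph.connect (fun u v => [set u; v]%SET \in F) x y].

Definition induced_edges G S : {set {set V}} :=
  [set e in edges G | e \subset S]%SET.

Definition joined G S S' : bool :=
  [exists x in S, exists y in S', adj G x y].

(* Pairs (vertex set, edge set); is_subgraph tells which of them are graphs    *)
(* contained in G.                                                            *)
Definition subgraph : Type := ({set V} * {set {set V}})%type.
Definition verts (B : subgraph) : {set V} := B.1.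
Definition is_subgraph (B : subgraph) G : bool :=
  (B.2 \subset edges G) && [forall e in B.2, e \subset verts B].

Definition bramble G (BB : {set subgraph}) : bool :=
  [forall B in BB, is_subgraph B G && connected_graph (verts B) B.2] &&
  [forall B in BB, forall B' in BB,
     (verts B :&: verts B' != finset.set0) || joined G (verts B) (verts B')].

End GraphNotions.

(* H is a minor of G: pairwise disjoint branch sets phi x, each inducing a    *)
(* connected subgraph of G, with an edge of G between phi x and phi y for     *)
(* every edge xy of H.                                                        *)
Definition minor (W V : finType) (H : sgraph W) (G : sgraph V) : bool :=
  [exists phi : {ffun W -> {set V}},
    [&& [forall x, connected_graph (phi x) (induced_edges G (phi x))],
        [forall x, forall y, (x != y) ==> [disjoint phi x & phi y]]
      & [forall x, forall y, adj H x y ==> joined G (phi x) (phi y)]]].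

(* The bound t <= #|V| loses nothing: branch sets are nonempty and disjoint.  *)
Definition hadwiger (V : finType) (G : sgraph V) : nat :=
  \max_(t < #|V|.+1 | minor (complete_graph t) G) t.

Section FractionalHadwiger.
Variable R : realType.

Definition bramble_weight (V : finType) (BB : {set subgraph V})
    (w : subgraph V -> R) : Prop :=
  (forall B, B \in BB -> 0 <= w B) /\
  (forall v : V, \sum_(B in BB | v \in verts B) w B <= 1).

Definition frac_hadwiger_values (V : finType) (G : sgraph V) : set R :=
  [set x | exists (BB : {set subgraph V}) (w : subgraph V -> R),
     [/\ bramble G BB, bramble_weight BB w & x = \sum_(B in BB) w B]]%classic.

(* The supremum is attained, see frac_hadwiger_max.                           *)
Definition frac_hadwiger (V : finType) (G : sgraph V) : R :=
  sup (frac_hadwiger_values G).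

(* The law of G(n, p) on the finite set of graphs with vertex set 'I_n.       *)
Definition gnp_mass (n : nat) (p : R) (G : sgraph 'I_n) : R :=
  \prod_(e in pairs 'I_n) (if e \in edges G then p else 1 - p).

Definition gnp_prob (n : nat) (p : R) (A : pred (sgraph 'I_n)) : R :=
  \sum_(G | A G) gnp_mass p G.

Definition almost_surely (p : R) (A : forall n, pred (sgraph 'I_n)) : Prop :=
  (gnp_prob p (A n) @[n --> \oo] --> (1 : R))%classic.

Definition log_base (b x : R) : R := ln x / ln b.

End FractionalHadwiger.

Arguments frac_hadwiger {R V} G.

Lemma gnp_prob_total (R : realType) (n : nat) (p : R) :
  gnp_prob p (@predT (sgraph 'I_n)) = 1.
Proof.
pose f e (b : bool) : R := if e \in pairs 'I_n then (if b then p else 1 - p)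
                           else (~~ b)%:R.
have : \prod_(e : {set 'I_n}) \sum_(b : bool) f e b = 1.
  apply: big1 => e _; rewrite big_bool /f.
  by case: ifP => _ /=; rewrite ?add0r // addrC subrK.
rewrite bigA_distr_bigA /= => <-.
pose h (G : sgraph 'I_n) : {ffun {set 'I_n} -> bool} := [ffun e => e \in edges G].
have sE (g : {ffun {set 'I_n} -> bool}) :
    [set e in pairs 'I_n | g e]%SET \subset pairs 'I_n.
  by apply/fintype.subsetP => e; rewrite inE => /andP[].
pose k (g : {ffun {set 'I_n} -> bool}) := SGraph (sE g).
rewrite [RHS](bigID (fun g : {ffun {set 'I_n} -> bool} => h (k g) == g)) /=.
rewrite [X in _ = _ + X]big1 ?addr0 => [|g ng]; last first.
  have [e] : exists e, h (k g) e != g e.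
    apply/existsP; apply: contraR ng; rewrite negb_exists => /forallP ng.
    by apply/eqP/ffunP => e; apply/eqP; rewrite -[_ == _]negbK.
  rewrite ffunE /= inE => Hne; rewrite (bigD1 e) //= /f.
  case: (e \in pairs 'I_n) Hne; first by rewrite eqxx.
  by case: (g e) => //= _; rewrite mul0r.
rewrite (reindex_onto h k) /=; last by move=> g /eqP.
rewrite /gnp_prob; apply: eq_big => [G|G _].
  have hkG : k (h G) = G.
    apply/val_inj/setP => e; rewrite /= inE ffunE.
    have := fintype.subsetP (edges_pairs G) e.
    by case: (e \in edges G) => [->|_]//; rewrite andbF.
  by rewrite hkG !eqxx.
rewrite /gnp_mass big_mkcond; apply: eq_bigr => e _; rewrite /f ffunE.
case: ifP => // ne.
have := fintype.subsetP (edges_pairs G) e.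
by case: (e \in edges G) => // /(_ isT); rewrite ne.
Qed.

Lemma hadwiger_minor (V : finType) (G : sgraph V) :
  minor (complete_graph (hadwiger G)) G.
Proof.
rewrite /hadwiger; elim/big_ind: _ => //.
  apply/existsP; exists [ffun=> finset.set0].
  by apply/and3P; split; apply/forallP => -[].
by move=> x y mx my; rewrite /maxn; case: ifP.
Qed.

Lemma leq_hadwiger (V : finType) (G : sgraph V) (t : nat) :
  minor (complete_graph t) G -> (t <= hadwiger G)%N.
Proof.
move=> mt; have lt : (t < #|V|.+1)%N.
  case/existsP: mt => phi /and3P[/forallP con /forallP disj _].
  have ne i : exists x, x \in phi i by apply/set0Pn; case/andP: (con i).
  have inj : injective (fun i => xchoose (ne i)).
    move=> i j /= eij; apply/eqP; apply: contraT => nij.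
    have := forallP (disj i) j; rewrite nij => /pred0P/(_ (xchoose (ne i)))/=.
    by rewrite (xchooseP (ne i)) eij (xchooseP (ne j)).
  by have := leq_card _ inj; rewrite card_ord ltnS.
exact: (@leq_bigmax_cond _ (fun t : 'I_#|V|.+1 => minor (complete_graph t) G)
  (fun t => t : nat) (Ordinal lt)).
Qed.

Lemma bramble_weight_max (R : realType) (V : finType) (G : sgraph V)
    (BB : {set subgraph V}) :
  bramble G BB ->
  exists2 w : subgraph V -> R, bramble_weight BB w &
    forall w' : subgraph V -> R, bramble_weight BB w' ->
      \sum_(B in BB) w' B <= \sum_(B in BB) w B.
Proof.
move=> /andP[/forallP/= con _].
pose T := subgraph V : finType.
pose c (B : T) (M : 'rV[R]_#|T|) : R := M ord0 (enum_rank B).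
have cc B : continuous (c B) by exact: coord_continuous.
have sumc (P : pred T) : continuous (fun M => \sum_(B | P B) c B M).
  by apply: continuous_big => [|B _]; [exact: add_continuous|exact: cc].
pose A : set 'rV[R]_#|T| := (
  [set M : 'rV[R]_#|T| | forall i, `[0, 1]%classic (M ord0 i)] `&`
  [set M : 'rV[R]_#|T| | forall v : V, \sum_(B in BB | v \in verts B) c B M <= 1])%classic.
have cA : compact A.
  apply: compact_closedI.
    apply: (@rV_compact R _ (fun=> `[0, 1]%classic)) => i.
    exact: segment_compact.
  rewrite (_ : [set _ | _]%classic = (\bigcap_(v in [set: V])
    (fun M => \sum_(B in BB | v \in verts B) c B M) @^-1` [set x : R | (x <= 1)%R])%classic).
    apply: closed_bigI => v _; apply: preimage_closed; last exact: closed_le.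
    by move=> M _; exact: sumc.
  by apply/seteqP; split=> [M h v _|M h v]; [exact: h|exact: h v I].
have A0 : (A !=set0)%classic.
  exists 0; split=> [i|v] /=; first by rewrite mxE in_itv /= lexx ler01.
  by rewrite big1 ?ler01// => B _; rewrite /c mxE.
have [M /set_mem[M01 M1] Mmax] := compact_EVT_max A0 cA
  (continuous_subspaceT (sumc (mem BB))).
exists (fun B => c B M).
  by split=> [B _|//]; have := M01 (enum_rank B); rewrite /= in_itv /= => /andP[].
move=> w' [w'0 w'1].
pose M' : 'rV[R]_#|T| := \row_i (if enum_val i \in BB then w' (enum_val i) else 0).
have cM' B : B \in BB -> c B M' = w' B by move=> BBB; rewrite /c mxE enum_rankK BBB.
rewrite -(eq_bigr _ cM'); apply: (Mmax M'); apply/mem_set; split=> [i|v] /=.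
  rewrite mxE in_itv /=; case: ifP => [iBB|_]; last by rewrite lexx ler01.
  rewrite w'0 //=.
  have := con (enum_val i); rewrite iBB /= => /andP[_ /andP[/set0Pn[v vi] _]].
  apply: le_trans (w'1 v); rewrite (bigD1 (enum_val i)) /=; last by rewrite iBB.
  by rewrite lerDl sumr_ge0 // => B /andP[/andP[BBB _] _]; exact: w'0.
rewrite (le_trans _ (w'1 v))// le_eqVlt; apply/orP; left; apply/eqP.
by apply: eq_bigr => B /andP[BBB _]; exact: cM'.
Qed.

Lemma frac_hadwiger_max (R : realType) (V : finType) (G : sgraph V) :
  @frac_hadwiger_values R V G (frac_hadwiger G) /\
  ubound (@frac_hadwiger_values R V G) (frac_hadwiger G).
Proof.
have b0 : bramble G finset.set0.
  by apply/andP; split; apply/forallP => B; rewrite finset.inE.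
pose val (BB : {set subgraph V}) : R :=
  if pselect (bramble G BB) is left h
  then \sum_(B in BB) sval (cid2 (@bramble_weight_max R V G BB h)) B else 0.
pose BBm := [arg max_(BB > finset.set0 | bramble G BB) val BB]%O.
have [bm mx] : bramble G BBm /\ forall BB, bramble G BB -> val BB <= val BBm.
  by rewrite /BBm; case: arg_maxP.
have inm : @frac_hadwiger_values R V G (val BBm).
  rewrite /val; case: pselect => // h; case: cid2 => w hw _ /=.
  by exists BBm, w.
have ubm : ubound (@frac_hadwiger_values R V G) (val BBm).
  move=> _ [BB [w [hBB hw ->]]]; apply: le_trans (mx BB hBB).
  by rewrite /val; case: pselect => // h; case: cid2 => w' _ /= /(_ w hw).
suff -> : frac_hadwiger G = val BBm by [].
apply/eqP; rewrite eq_le; apply/andP; split.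
  by apply: ge_sup => //; exists (val BBm).
by apply: ub_le_sup => //; exists (val BBm).
Qed.

(* Main.v *)
(** Put k = sqrt (log_b n) and q = 1 - p, so that q ^ (k ^ 2) = 1 / n.

    Lower bound, already for the Hadwiger number: cut the vertex set into
    m = n / s blocks of size s, s slightly larger than k. Two blocks are not
    joined with probability q ^ (s ^ 2) <= 1 / n, and a block is disconnected
    with probability tending to 0, so the expected number of defects is o(m);
    by Markov's inequality, deleting one block per defect leaves a complete
    minor of order (1 - o(1)) m.

    Upper bound: in a fractional bramble of weight (1 + d) n / k the sets of
    size greater than s = k / (1 + d / 2) weigh at most (1 + d / 2) n / k. The
    remaining sets weigh at least (d / 2) n / k, and choosing greedily among
    them gives M of order n / k ^ 2 disjoint sets of size at most s which are
    pairwise joined. A union bound over the n ^ (s M) possible families shows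
    that this is unlikely: each family is pairwise joined with probability at
    most (1 - q ^ (s ^ 2)) ^ (M choose 2), and q ^ (s ^ 2) is at least
    n ^ (- c) for some c < 1. *)

Require Import Defs.
From mathcomp Require Import all_boot all_order all_algebra.
From mathcomp Require Import all_classical all_reals all_analysis.
From mathcomp Require Import ring lra zify.
Set Implicit Arguments.
Unset Strict Implicit.
Unset Printing Implicit Defensive.
Import Order.TTheory GRing.Theory Num.Theory.
Local Open Scope ring_scope.

(** * Probability in G(n, p) *)

Section GnpProbability.
Variables (R : realType) (n : nat) (p : R).
Hypotheses (p_ge0 : 0 <= p) (p_le1 : p <= 1).
Implicit Types (G H : sgraph 'I_n) (E F : {set {set 'I_n}}).
Implicit Types (A B : pred (sgraph 'I_n)).

Local Notation P := (@gnp_prob R n p).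

Lemma gnp_mass_ge0 G : 0 <= gnp_mass p G.
Proof. by apply: prodr_ge0 => e _; case: ifP => // _; rewrite subr_ge0. Qed.

Lemma gnp_prob_ge0 A : 0 <= P A.
Proof. by apply: sumr_ge0 => G _; exact: gnp_mass_ge0. Qed.

Lemma le_gnp_prob A B : (forall G, A G -> B G) -> P A <= P B.
Proof.
move=> AB; rewrite /gnp_prob big_mkcond [leRHS]big_mkcond.
apply: ler_sum => G _; case: ifP => [/AB -> //|_].
by case: ifP => // _; exact: gnp_mass_ge0.
Qed.

Lemma eq_gnp_prob A B : A =1 B -> P A = P B.
Proof. exact: eq_bigl. Qed.

Lemma gnp_probC A : P (fun G => ~~ A G) = 1 - P A.
Proof.
apply/eqP; rewrite eq_sym subr_eq -(gnp_prob_total n p) addrC; apply/eqP.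
exact: bigID.
Qed.

Lemma gnp_prob_le1 A : P A <= 1.
Proof. by rewrite -subr_ge0 -gnp_probC gnp_prob_ge0. Qed.

Lemma gnp_probU A B : P (fun G => A G || B G) <= P A + P B.
Proof.
rewrite /gnp_prob [leLHS]big_mkcond [X in _ <= X + _]big_mkcond.
rewrite [X in _ <= _ + X]big_mkcond -big_split.
apply: ler_sum => G _; have := gnp_mass_ge0 G.
by case: (A G) (B G) => [] [] /=; lra.
Qed.

(** Union bound: once the sums are exchanged, a graph in the union is counted by at least one
    summand. *)
Lemma gnp_prob_exists (I : finType) (Q : pred I) (A : I -> pred (sgraph 'I_n)) :
  P (fun G => [exists i, Q i && A i G]) <= \sum_(i | Q i) P (A i).
Proof.
rewrite /gnp_prob (exchange_big_dep predT) //= [leLHS]big_mkcond.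
apply: ler_sum => G _; case: ifP => [/existsP[i Hi]|_].
  rewrite (bigD1 i) //= lerDl.
  by apply: sumr_ge0 => ? _; exact: gnp_mass_ge0.
by apply: sumr_ge0 => ? _; exact: gnp_mass_ge0.
Qed.

Lemma gnp_markov (f : sgraph 'I_n -> R) (c : R) : (forall G, 0 <= f G) ->
  c * P (fun G => c <= f G) <= \sum_G gnp_mass p G * f G.
Proof.
move=> f0; rewrite /gnp_prob big_distrr /= [leLHS]big_mkcond.
apply: ler_sum => G _; have m0 := gnp_mass_ge0 G; case: ifP => [cf|_].
  by rewrite mulrC ler_wpM2l.
exact: mulr_ge0.
Qed.

Lemma gnp_expectation_indicator A : \sum_G gnp_mass p G * (A G)%:R = P A.
Proof.
rewrite /gnp_prob [RHS]big_mkcond; apply: eq_bigr => G _.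
by case: (A G); rewrite ?mulr1 ?mulr0.
Qed.

(** Measurability of [A] with respect to the indicators of the pairs in [E]; events measurable over
    disjoint [E] are independent. *)
Definition depends_on E A := forall G H,
  {in E, forall e, (e \in edges G) = (e \in edges H)} -> A G = A H.

Lemma splice_subproof E G H :
  [set e in pairs 'I_n | if e \in E then e \in edges G else e \in edges H]%SET
    \subset pairs 'I_n.
Proof. by apply/fintype.subsetP => e; rewrite inE => /andP[]. Qed.

Lemma sgraph_eq G H : edges G =i edges H -> G = H.
Proof. by move=> GH; apply/val_inj/setP. Qed.

Definition splice E G H : sgraph 'I_n := SGraph (splice_subproof E G H).

Lemma in_splice E G H e :
  (e \in edges (splice E G H)) = if e \in E then e \in edges G else e \in edges H.
Proof.
rewrite /splice inE; have := fintype.subsetP (edges_pairs G) e.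
have := fintype.subsetP (edges_pairs H) e.
case: ifP => _; [move=> _|move=> + _].
  by case: (e \in edges G) => [->|_]; rewrite ?andbF.
by case: (e \in edges H) => [->|_]; rewrite ?andbF.
Qed.

(* Exchanging G and H outside E is a mass-preserving involution on pairs of
   graphs which turns A G && B H into A G && B G. *)
Lemma gnp_prob_indep E F A B : [disjoint E & F] ->
  depends_on E A -> depends_on F B -> P (fun G => A G && B G) = P A * P B.
Proof.
(* The factor 1, the total mass, turns the left side into a sum over pairs of graphs as well. *)
move=> dEF dA dB; rewrite -[LHS]mulr1 -(gnp_prob_total n p) /gnp_prob.
rewrite !big_distrlr /= !pair_big_dep /=.
pose sw (GH : sgraph 'I_n * sgraph 'I_n) :=
  (splice E GH.1 GH.2, splice E GH.2 GH.1).
have swK : involutive sw.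
  move=> [G H]; rewrite /sw /=; congr pair; apply: sgraph_eq => e;
  by rewrite !in_splice; case: (e \in E).
rewrite (reindex_inj (inv_inj swK)); apply: eq_big => [[G H]|[G H] _] /=.
  rewrite andbT; congr andb; first by apply: dA => e eE; rewrite in_splice eE.
  apply: dB => e eF; rewrite in_splice; case: ifP => // eE.
  by have := disjointFr dEF eE; rewrite eF.
rewrite /gnp_mass -!big_split; apply: eq_bigr => e _ /=.
by rewrite !in_splice; case: (e \in E) => //; rewrite mulrC.
Qed.

Lemma depends_on_all (I : eqType) (r : seq I) (E : I -> {set {set 'I_n}})
    (A : I -> pred (sgraph 'I_n)) :
  (forall i, i \in r -> depends_on (E i) (A i)) ->
  depends_on (\bigcup_(i <- r) E i)%SET (fun G => all (A^~ G) r).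
Proof.
elim: r => // i r IH d; rewrite big_cons => G H GH /=; congr andb.
  by apply: d; rewrite ?mem_head // => e eE; apply: GH; rewrite inE eE.
apply: IH => [j jr|e eE]; first by apply: d; rewrite inE jr orbT.
by apply: GH; rewrite inE eE orbT.
Qed.

Lemma gnp_prob_all_indep (I : eqType) (r : seq I) (E : I -> {set {set 'I_n}})
    (A : I -> pred (sgraph 'I_n)) : uniq r ->
  {in r &, forall i j, i != j -> [disjoint E i & E j]} ->
  (forall i, i \in r -> depends_on (E i) (A i)) ->
  P (fun G => all (A^~ G) r) = \prod_(i <- r) P (A i).
Proof.
elim: r => [_ _ _|i r IH /= /andP[ir ur] dj d].
  by rewrite big_nil -(gnp_prob_total n p).
have dr j : j \in r -> depends_on (E j) (A j).
  by move=> jr; apply: d; rewrite inE jr orbT.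
rewrite big_cons -IH //; last first.
  by move=> j k jr kr; apply: dj; rewrite inE ?jr ?kr orbT.
apply: (gnp_prob_indep _ (d i (mem_head _ _)) (depends_on_all dr)).
rewrite big_seq; elim/big_rec: _ => [|j X jr dX].
  by rewrite disjoint_sym -setI_eq0 finset.set0I.
rewrite -setI_eq0 finset.setIUr finset.setU_eq0 !setI_eq0 dX andbT.
apply: dj; rewrite ?mem_head // ?inE ?jr ?orbT //.
by apply: contraNneq ir => ->.
Qed.

Lemma gnp_prob_forall_indep (I : finType) (Q : pred I)
    (E : I -> {set {set 'I_n}}) (A : I -> pred (sgraph 'I_n)) :
  {in Q &, forall i j, i != j -> [disjoint E i & E j]} ->
  (forall i, Q i -> depends_on (E i) (A i)) ->
  P (fun G => [forall i, Q i ==> A i G]) = \prod_(i | Q i) P (A i).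
Proof.
move=> dj d; rewrite -big_filter -(@gnp_prob_all_indep _ _ E) /=.
- apply: eq_gnp_prob => G; apply/forallP/allP => [AG i|AG i].
    by rewrite mem_filter => /andP[Qi _]; have := AG i; rewrite Qi.
  by apply/implyP => Qi; apply: AG; rewrite mem_filter Qi mem_index_enum.
- by rewrite filter_uniq // index_enum_uniq.
- move=> i j; rewrite !mem_filter => /andP[Qi _] /andP[Qj _]; exact: dj.
- by move=> i; rewrite mem_filter => /andP[Qi _]; exact: d.
Qed.

(** Splicing in the empty or the complete graph at [e] flips [e] and keeps all other pairs. *)
Definition toggle e G : sgraph 'I_n :=
  splice [set e]%SET (if e \in edges G then SGraph (finset.sub0set _)
                      else SGraph (fintype.subxx _)) G.

Lemma in_toggle e G f : e \in pairs 'I_n ->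
  (f \in edges (toggle e G)) = (f == e) (+) (f \in edges G).
Proof.
move=> pe; rewrite in_splice finset.in_set1; case: eqP => //= ->.
by case: (e \in edges G); rewrite //= finset.in_set0.
Qed.

(** Toggling [e] matches the graphs containing [e] with those avoiding it and exchanges a factor p
    for 1 - p. This gives one linear equation between the two probabilities, and they sum to 1. *)
Lemma gnp_prob_edge e : e \in pairs 'I_n -> P (fun G => e \in edges G) = p.
Proof.
move=> pe; have tK : involutive (toggle e).
  move=> G; apply: sgraph_eq => f; rewrite !in_toggle //.
  by case: eqP => //= _; rewrite negbK.
have : (1 - p) * P (fun G => e \in edges G) = p * P (fun G => e \notin edges G).
  rewrite /gnp_prob !big_distrr /= (reindex_inj (inv_inj tK)).
  apply: eq_big => G; first by rewrite in_toggle // eqxx addTb.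
  rewrite in_toggle // eqxx addTb => /negbTE eG.
  rewrite /gnp_mass (bigD1 e) // in_toggle // eqxx eG.
  rewrite [in RHS](bigD1 e) // eG mulrCA; congr (_ * (_ * _)).
  by apply: eq_bigr => f /andP[_ /negbTE fe]; rewrite in_toggle // fe.
rewrite gnp_probC; lra.
Qed.

Lemma gnp_prob_all_edges E : E \subset pairs 'I_n ->
  P (fun G => E \subset edges G) = p ^+ #|E|.
Proof.
move=> /fintype.subsetP sE.
have := @gnp_prob_forall_indep _ (mem E) (fun e => [set e]%SET)
  (fun e G => e \in edges G).
rewrite (eq_bigr (fun=> p)); last by move=> e /sE; exact: gnp_prob_edge.
rewrite prodr_const => <- //.
- apply: eq_gnp_prob => G; apply/fintype.subsetP/forallP => EG e.
    by apply/implyP; exact: EG.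
  by move=> eE; have := EG e; rewrite inE eE.
- by move=> e f _ _ ef; rewrite disjoints1 finset.in_set1.
- by move=> e _ G H; apply; rewrite finset.in_set1.
Qed.

Lemma gnp_prob_no_edge E : E \subset pairs 'I_n ->
  P (fun G => [disjoint E & edges G]) = (1 - p) ^+ #|E|.
Proof.
move=> /fintype.subsetP sE.
have := @gnp_prob_forall_indep _ (mem E) (fun e => [set e]%SET)
  (fun e G => e \notin edges G).
rewrite (eq_bigr (fun=> 1 - p)); last first.
  by move=> e /sE pe; rewrite gnp_probC gnp_prob_edge.
rewrite prodr_const => <- //.
- apply: eq_gnp_prob => G; apply/idP/forallP => [EG e|EG].
    by apply/implyP => eE; rewrite (disjointFr EG eE).
  rewrite disjoint_subset; apply/fintype.subsetP => e eE.
  by have := EG e; rewrite !inE eE.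
- by move=> e f _ _ ef; rewrite disjoints1 finset.in_set1.
- by move=> e _ G H GH; rewrite GH ?finset.in_set1.
Qed.

End GnpProbability.

(** * Events of probability tending to 1 *)

Section AlmostSurely.
Variables (R : realType) (p : R).
Hypotheses (p_ge0 : 0 <= p) (p_le1 : p <= 1).
Implicit Types A B : forall n, pred (sgraph 'I_n).

Lemma almost_surely_near A :
  (forall eps : R, 0 < eps -> \forall n \near \oo%classic,
     gnp_prob p (fun G => ~~ A n G) <= eps) -> almost_surely p A.
Proof.
move=> h; apply/cvgrPdist_le => eps eps0; apply: filterS (h _ eps0) => n.
by rewrite gnp_probC => H; rewrite ger0_norm // subr_ge0 gnp_prob_le1.
Qed.

Lemma almost_surelyS A B : (\forall n \near \oo%classic, forall G, A n G -> B n G) ->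
  almost_surely p A -> almost_surely p B.
Proof.
move=> AB /cvgrPdist_le h; apply: almost_surely_near => eps eps0.
apply: filterS2 AB (h _ eps0) => n ABn; rewrite ger0_norm ?subr_ge0 ?gnp_prob_le1 //.
apply: le_trans; rewrite -gnp_probC; apply: le_gnp_prob => // G.
by apply: contra; exact: ABn.
Qed.

Lemma almost_surelyI A B : almost_surely p A -> almost_surely p B ->
  almost_surely p (fun n G => A n G && B n G).
Proof.
move=> /cvgrPdist_le hA /cvgrPdist_le hB; apply: almost_surely_near => eps eps0.
have e2 : 0 < eps / 2 by rewrite divr_gt0.
apply: filterS2 (hA _ e2) (hB _ e2) => n.
rewrite !ger0_norm ?subr_ge0 ?gnp_prob_le1 // -!gnp_probC => a b.
rewrite [leRHS]splitr; apply: le_trans (lerD a b).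
apply: le_trans (gnp_probU p_ge0 p_le1 _ _).
by apply: le_gnp_prob => // G; rewrite negb_and.
Qed.

End AlmostSurely.

(** * Brambles and minors *)

Section Combinatorics.
Variable V : finType.
Implicit Types (G : sgraph V) (S T : {set V}).

Definition cross_edges S T : {set {set V}} :=
  [set [set u.1; u.2]%SET | u in finset.setX S T]%SET.

Lemma cross_edgesP S T e :
  reflect (exists x y, [/\ x \in S, y \in T & e = [set x; y]%SET])
          (e \in cross_edges S T).
Proof.
apply: (iffP imsetP) => [[[x y]]|[x [y [xS yT ->]]]].
  by rewrite inE /= => /andP[xS yT] ->; exists x, y.
by exists (x, y); rewrite ?inE /= ?xS.
Qed.

Lemma in_disjoint_neq S T x y : [disjoint S & T] -> x \in S -> y \in T -> x != y.
Proof.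
by move=> d xS; apply: contraTneq => <-; rewrite (disjointFr d xS).
Qed.

Lemma cross_edges_pairs S T : [disjoint S & T] -> cross_edges S T \subset pairs V.
Proof.
move=> d; apply/fintype.subsetP => e /cross_edgesP[x [y [xS yT ->]]].
by rewrite inE cards2 (in_disjoint_neq d xS yT).
Qed.

Lemma set2_eq (x y x' y' : V) : [set x; y]%SET = [set x'; y']%SET ->
  (x = x' /\ y = y') \/ (x = y' /\ y = x').
Proof.
move=> e.
have : x \in [set x'; y']%SET by rewrite -e !inE eqxx.
have : y \in [set x'; y']%SET by rewrite -e !inE eqxx orbT.
have : x' \in [set x; y]%SET by rewrite e !inE eqxx.
have : y' \in [set x; y]%SET by rewrite e !inE eqxx orbT.
rewrite !inE => /orP[]/eqP + /orP[]/eqP + /orP[]/eqP + /orP[]/eqP +;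
  move=> *; subst; by [left|right].
Qed.

(** On S x T the map from (x, y) to {x, y} is injective, since a swapped coincidence would put a
    vertex in both sets. *)
Lemma card_cross_edges S T : [disjoint S & T] ->
  #|cross_edges S T| = (#|S| * #|T|)%N.
Proof.
move=> d; rewrite card_in_imset ?finset.cardsX // => -[x y] [x' y'] /=.
rewrite !inE /= => /andP[xS yT] /andP[xS' yT'] /set2_eq[[-> ->]//|[E _]].
by have := in_disjoint_neq d xS yT'; rewrite E eqxx.
Qed.

(** Puts [joined] in the form of the event of [gnp_prob_no_edge]. *)
Lemma joinedE G S T : joined G S T = ~~ [disjoint cross_edges S T & edges G].
Proof.
apply/existsP/pred0Pn => [[x /andP[xS /existsP[y /andP[yT xy]]]]|[e /=]].
  by exists [set x; y]%SET; rewrite /= [_ \in edges _]xy andbT; apply/cross_edgesP; exists x, y.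
move=> /andP[/cross_edgesP[x [y [xS yT ->]]] xy].
by exists x; rewrite xS; apply/existsP; exists y; rewrite yT.
Qed.

Lemma joinedC G S T : joined G S T = joined G T S.
Proof.
suff imp A B : joined G A B -> joined G B A by apply/idP/idP; exact: imp.
move=> /existsP[x /andP[xS /existsP[y /andP[yT xy]]]].
apply/existsP; exists y; rewrite yT; apply/existsP; exists x.
by rewrite xS /adj finset.setUC.
Qed.

Lemma disjoint_family_eq (I : eqType) (S : I -> {set V}) i j x :
  (forall i j, i != j -> [disjoint S i & S j]) ->
  x \in S i -> x \in S j -> i = j.
Proof.
move=> dj xi xj; apply/eqP; apply: contraT => /dj d.
by rewrite (disjointFr d xi) in xj.
Qed.

(** Each end of an edge lies in only one set of the family, so a common edge determines the pair of
    indices up to order. This yields independence of the joinings. *)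
Lemma cross_edges_disjoint (I : eqType) (S : I -> {set V}) i j k l :
  (forall i j, i != j -> [disjoint S i & S j]) ->
  (i, j) != (k, l) -> (i, j) != (l, k) ->
  [disjoint cross_edges (S i) (S j) & cross_edges (S k) (S l)].
Proof.
move=> dj n1 n2; apply/pred0P => e /=; apply/negP.
move=> /andP[/cross_edgesP[x [y [xi yj ->]]] /cross_edgesP[x' [y' [xk yl]]]].
have eqI := disjoint_family_eq dj.
move=> /set2_eq[] [E1 E2]; subst x' y'.
  by move: n1; rewrite (eqI _ _ _ xi xk) (eqI _ _ _ yj yl) eqxx.
by move: n2; rewrite (eqI _ _ _ xi yl) (eqI _ _ _ yj xk) eqxx.
Qed.

(* Discarding from the family the sets that meet a chosen set S loses weight
   at most #|S|, so the greedy choice of disjoint sets gives the bound. *)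
Lemma greedy_disjoint (R : realType) (T : finType) (f : T -> {set V})
    (BB : {set T}) (w : T -> R) (s : nat) :
  (forall B, B \in BB -> f B != finset.set0) ->
  (forall B, B \in BB -> (#|f B| <= s)%N) ->
  (forall B, B \in BB -> 0 <= w B) ->
  (forall v, \sum_(B in BB | v \in f B) w B <= 1) ->
  exists D : {set T}, [/\ D \subset BB,
    {in D &, forall B B', B != B' -> [disjoint f B & f B']} &
    \sum_(B in BB) w B <= s%:R * #|D|%:R].
Proof.
move: {2}#|BB| (leqnn #|BB|) => N; elim: N BB => [|N IH] BB.
  rewrite leqn0 cards_eq0 => /eqP -> _ _ _ _; exists finset.set0; split => //.
    by move=> B; rewrite inE.
  by rewrite big_set0 finset.cards0 mulr0.
have [->|[B0 B0in]] := set_0Vmem BB.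
  move=> _ _ _ _ _; exists finset.set0; split => //.
    by move=> B; rewrite inE.
  by rewrite big_set0 finset.cards0 mulr0.
move=> cBB ne sz w0 w1.
pose BB' := [set B in BB | [disjoint f B & f B0]]%SET.
have sBB' B : B \in BB' -> B \in BB by rewrite inE => /andP[].
have ltBB' : BB' \proper BB.
  apply/properP; split; first exact/fintype.subsetP.
  (* A nonempty set is not disjoint from itself, so [B0] is discarded too and the induction
     proceeds. *)
  exists B0 => //; rewrite inE B0in /=; apply: contra (ne _ B0in).
  by rewrite -setI_eq0 finset.setIid.
have [|||||D [sD dD wD]] := IH BB'.
- by have := proper_card ltBB'; lia.
- by move=> B /sBB'; exact: ne.
- by move=> B /sBB'; exact: sz.
- by move=> B /sBB'; exact: w0.
- move=> v; apply: le_trans (w1 v); rewrite [leLHS]big_mkcond [leRHS]big_mkcond.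
  apply: ler_sum => B _; case: (boolP (B \in BB')) => [/sBB' -> //|_] /=.
  by case: ifP => // /andP[/w0].
have B0D : B0 \notin D.
  apply: contraT => /negbNE/(fintype.subsetP sD); rewrite inE => /andP[_].
  by rewrite -setI_eq0 finset.setIid => E; have := ne _ B0in; rewrite E.
exists (B0 |: D)%SET; split.
- rewrite finset.subUset finset.sub1set B0in.
  exact: fintype.subset_trans sD (proper_sub ltBB').
- move=> B B'; rewrite !inE => /orP[/eqP->|BD] /orP[/eqP->|BD'].
  + by rewrite eqxx.
  + by move=> _; have /(fintype.subsetP sD) := BD';
      rewrite inE disjoint_sym => /andP[].
  + by move=> _; have /(fintype.subsetP sD) := BD; rewrite inE => /andP[].
  + exact: dD.
rewrite finset.cardsU1 B0D natrD mulrDr mulr1.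
rewrite (bigID (fun B => [disjoint f B & f B0])) /= addrC lerD //; last first.
  by apply: le_trans wD; rewrite le_eqVlt; apply/orP; left; apply/eqP;
    apply: eq_bigl => B; rewrite inE.
apply: (@le_trans _ _ (\sum_(v in f B0) 1)); last first.
  by rewrite sumr_const ler_nat sz.
(* Every set that meets [f B0] is counted at one of its vertices at least, and each vertex carries
   weight at most 1. *)
apply: (@le_trans _ _ (\sum_(v in f B0) \sum_(B in BB | v \in f B) w B)); last first.
  by apply: ler_sum => v _; exact: w1.
rewrite (exchange_big_dep (mem BB)) /=; last by move=> v B _ /andP[].
rewrite [leLHS]big_mkcondr; apply: ler_sum => B BBB.
have w0B := w0 _ BBB; case: ifP => [/pred0Pn[v /= /andP[vB vB0]]|_]; last first.
  by apply: sumr_ge0 => v _; exact: w0.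
rewrite (bigD1 v) /= ?vB ?vB0 ?BBB // lerDl.
by apply: sumr_ge0 => ? _; exact: w0.
Qed.

(** The branch sets of a largest complete minor form a bramble. With weight 1 on each, disjointness
    keeps the load of every vertex at most 1. *)
Lemma hadwiger_le_frac (R : realType) G : (hadwiger G)%:R <= frac_hadwiger G :> R.
Proof.
have [_] := @frac_hadwiger_max R V G; apply.
have /existsP[phi /and3P[/forallP con /forallP disj /forallP adjP]] :=
  hadwiger_minor G.
pose h (i : 'I_(hadwiger G)) : subgraph V := (phi i, induced_edges G (phi i)).
have dj i j : i != j -> [disjoint phi i & phi j].
  by move=> ij; have := forallP (disj i) j; rewrite ij.
have ne i : phi i != finset.set0 by have /andP[] := con i.
have hI : injective h.
  move=> i j [E _]; apply/eqP; apply: contraT => /dj.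
  by rewrite E -setI_eq0 finset.setIid (negbTE (ne j)).
exists (h @: finset.setT)%SET, (fun=> 1); split; last first.
- by rewrite sumr_const card_imset // cardsT card_ord.
- split=> [B _|v]; first exact: ler01.
  have [[i vi]|nv] := pselect (exists i, v \in phi i); last first.
    rewrite big1 ?ler01 // => B /andP[/imsetP[i _ ->] vi].
    by case: nv; exists i.
  rewrite sumr_const -[leRHS]/(1%:R) ler_nat.
  rewrite -(cards1 (h i)); apply/subset_leq_card/fintype.subsetP => B.
  move=> /andP[/imsetP[j _ ->] vj]; rewrite inE; apply/eqP; congr h.
  by apply/eqP; apply: contraT => /dj/disjointFr/(_ vj); rewrite vi.
apply/andP; split.
  apply/forallP => B; apply/implyP => /imsetP[i _ ->]; rewrite con andbT.
  apply/andP; split; first by apply/fintype.subsetP => e; rewrite inE => /andP[].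
  by apply/forallP => e; apply/implyP; rewrite inE => /andP[].
apply/forallP => B; apply/implyP => /imsetP[i _ ->].
apply/forallP => B'; apply/implyP => /imsetP[j _ ->].
have [->|ij] := eqVneq i j; first by rewrite finset.setIid ne.
apply/orP; right; have /forallP/(_ j)/implyP := adjP i; apply.
by rewrite /adj /= inE cards2 ij.
Qed.

Lemma hadwiger_ge_family (I : finType) (S : I -> {set V}) (Q : {set I}) G :
  {in Q, forall i, connected_graph (S i) (induced_edges G (S i))} ->
  {in Q &, forall i j, i != j -> [disjoint S i & S j]} ->
  {in Q &, forall i j, i != j -> joined G (S i) (S j)} ->
  (#|Q| <= hadwiger G)%N.
Proof.
move=> con dj jn; apply: leq_hadwiger; apply/existsP.
exists [ffun i : 'I_#|Q| => S (enum_val i)].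
have nQ (i j : 'I_#|Q|) : i != j -> enum_val i != enum_val j.
  by apply: contra => /eqP/enum_val_inj ->.
apply/and3P; split; apply/forallP => i.
- by rewrite ffunE con ?enum_valP.
- apply/forallP => j; apply/implyP => ij; rewrite !ffunE.
  by rewrite dj ?enum_valP ?nQ.
- apply/forallP => j; apply/implyP; rewrite /adj /= inE cards2 => ij.
  have {}ij : i != j by case: (i != j) ij.
  by rewrite !ffunE jn ?enum_valP ?nQ.
Qed.

(** Delete every disconnected set and, for every unjoined pair, the set of smaller index; the
    remaining sets are the branch sets of a complete minor. *)
Lemma hadwiger_ge_delete (m : nat) (S : 'I_m -> {set V}) G :
  (forall i j, i != j -> [disjoint S i & S j]) ->
  (m <= hadwiger G
     + (\sum_i ~~ connected_graph (S i) (induced_edges G (S i))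
     + \sum_(ij : 'I_m * 'I_m | (ij.1 < ij.2)%N) ~~ joined G (S ij.1) (S ij.2)))%N.
Proof.
move=> dj.
pose D1 := [set i | ~~ connected_graph (S i) (induced_edges G (S i))]%SET.
pose X := [set ij : 'I_m * 'I_m | (ij.1 < ij.2)%N && ~~ joined G (S ij.1) (S ij.2)]%SET.
pose D2 := [set ij.1 | ij in X]%SET.
have h := @hadwiger_ge_family _ S (~: (D1 :|: D2))%SET G.
have c1 : #|D1| = (\sum_i ~~ connected_graph (S i) (induced_edges G (S i)))%N.
  by rewrite -sum1_card big_mkcond; apply: eq_bigr => i _; rewrite inE; case: ifP.
have c2 : (#|D2| <= \sum_(ij : 'I_m * 'I_m | (ij.1 < ij.2)%N)
    ~~ joined G (S ij.1) (S ij.2))%N.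
  apply: leq_trans (leq_imset_card _ _) _.
  rewrite -sum1_card big_mkcond [leqRHS]big_mkcond; apply: leq_sum => ij _.
  by rewrite inE; case: (_ < _)%N => //=; case: ifP.
have lt_joined (i j : 'I_m) : i \notin D2 -> (i < j)%N -> joined G (S i) (S j).
  move=> iD ij; apply: contraNT iD => nj; apply/imsetP; exists (i, j) => //.
  by rewrite inE ij.
have cU : (#|D1 :|: D2| <= #|D1| + #|D2|)%N by rewrite cardsU leq_subr.
have cC := cardsC (D1 :|: D2); rewrite card_ord in cC.
have {}h : (#|~: (D1 :|: D2)| <= hadwiger G)%N.
  apply: h => [i|i j _ _|i j]; first by rewrite !inE negb_or negbK => /andP[].
    exact: dj.
  rewrite finset.in_setC finset.in_setU negb_or => /andP[_ iD].
  rewrite finset.in_setC finset.in_setU negb_or => /andP[_ jD].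
  rewrite neq_ltn => /orP[ij|ji]; first exact: lt_joined.
  by rewrite joinedC lt_joined.
lia.
Qed.

(** A criterion by paths of length two from one root. Its failure is an event about a single [y],
    with independent conditions on the vertices [z]. *)
Lemma connected_via_common_neighbours G S x0 : x0 \in S ->
  (forall y, y \in S -> y != x0 -> exists z, [/\ z \in S, adj G x0 z & adj G y z]) ->
  connected_graph S (induced_edges G S).
Proof.
move=> x0S H; apply/andP; split; first by apply/set0Pn; exists x0.
pose e := [rel u v | [set u; v]%SET \in induced_edges G S].
have eC : symmetric e by move=> x y; rewrite /= finset.setUC.
have cC : connect_sym e by exact: sym_connect_sym.
have x0y y : y \in S -> fingraph.connect e x0 y.
  move=> yS; have [->|/H] := eqVneq y x0; first exact: connect0.
  move=> /(_ yS)[z [zS x0z yz]].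
  apply: (@connect_trans _ _ z); apply: connect1; last rewrite eC.
    by rewrite /= inE finset.subUset !finset.sub1set x0S zS !andbT; exact: x0z.
  by rewrite /= inE finset.subUset !finset.sub1set yS zS !andbT; exact: yz.
apply/forallP => x; apply/implyP => xS; apply/forallP => y; apply/implyP => yS.
apply: (@connect_trans _ e x0); last exact: x0y.
by rewrite cC; exact: x0y.
Qed.

End Combinatorics.

(** * Probabilities of graph events *)

(* The sets of size at most s are encoded as images of functions 'I_s -> V. *)
Definition joined_family (V : finType) (s M : nat) (G : sgraph V)
    (F : {ffun 'I_M -> {ffun 'I_s -> V}}) : bool :=
  [forall i, forall j, (i != j) ==>
    [disjoint F i @: finset.setT & F j @: finset.setT] &&
    joined G (F i @: finset.setT) (F j @: finset.setT)].

Lemma ffun_onto_set (V : finType) (s : nat) (S : {set V}) :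
  S != finset.set0 -> (#|S| <= s)%N ->
  exists g : {ffun 'I_s -> V}, (g @: finset.setT)%SET = S.
Proof.
(* The default [v] keeps the indices beyond [#|S|] inside [S]. *)
move=> /set0Pn[v vS] cS; exists [ffun i : 'I_s => nth v (enum S) i].
apply/setP => x; apply/imsetP/idP => [[i _ ->]|xS].
  rewrite ffunE; have [lt|ge] := ltnP i (size (enum S)).
    by rewrite -mem_enum mem_nth.
  by rewrite nth_default.
have lt : (index x (enum S) < s)%N.
  by apply: leq_trans cS; rewrite cardE index_mem mem_enum.
by exists (Ordinal lt) => //; rewrite ffunE /= nth_index // mem_enum.
Qed.

(** The weight of an optimal bramble is split at size [s]: double counting bounds the large sets,
    the greedy choice the small ones. *)
Lemma frac_hadwiger_le (R : realType) (V : finType) (G : sgraph V) (s M : nat) :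
  ~~ [exists F : {ffun 'I_M -> {ffun 'I_s -> V}}, joined_family G F] ->
  frac_hadwiger G <= #|V|%:R / s.+1%:R + s%:R * M%:R :> R.
Proof.
move=> noF; have [[BB [w [br [w0 w1] ->]]] _] := @frac_hadwiger_max R V G.
have /andP[/forallP con /forallP jn] := br.
have ne B : B \in BB -> verts B != finset.set0.
  by move=> BBB; have := con B; rewrite BBB /= => /andP[_ /andP[]].
pose BS := [set B in BB | (#|verts B| <= s)%N]%SET.
rewrite (bigID (fun B => (#|verts B| <= s)%N)) /= addrC lerD //.
  rewrite ler_pdivlMr ?ltr0n // mulrC.
  (* Summed over all vertices, a large set is counted at least s + 1 times, while the total is at
     most [#|V|]. *)
  apply: (@le_trans _ _ (\sum_(B in BB) \sum_(v in verts B) w B)).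
    rewrite big_distrr /= big_mkcondr; apply: ler_sum => B BBB.
    rewrite sumr_const; have := w0 _ BBB; case: ifP => h wB0.
      by rewrite -[leRHS]mulr_natl ler_wpM2r ?ler_nat // ltnNge.
    by rewrite mulrn_wge0.
  rewrite (exchange_big_dep predT) //=.
  apply: (@le_trans _ _ (\sum_(v : V) 1)); last by rewrite sumr_const.
  by apply: ler_sum => v _; exact: w1.
have [||||D [sD dD wD]] := @greedy_disjoint V R _ (@verts V) BS w s.
- by move=> B; rewrite inE => /andP[/ne].
- by move=> B; rewrite inE => /andP[].
- by move=> B; rewrite inE => /andP[/w0].
- move=> v; apply: le_trans (w1 v); rewrite [leLHS]big_mkcond [leRHS]big_mkcond.
  apply: ler_sum => B _; rewrite inE; case: (boolP (B \in BB)) => //= BBB.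
  by case: (_ <= _)%N => //=; case: ifP => // _; exact: w0.
apply: (@le_trans _ _ (\sum_(B in BS) w B)).
  by rewrite le_eqVlt; apply/orP; left; apply/eqP; apply: eq_bigl => B; rewrite inE.
(* With more than [M] greedy sets, the first [M] would be a joined family: disjoint members of a
   bramble must be joined. *)
apply: le_trans wD _; rewrite ler_wpM2l // ler_nat leqNgt.
apply: contra noF => ltD.
have ex (i : 'I_#|D|) :
    exists g : {ffun 'I_s -> V}, (g @: finset.setT)%SET = verts (enum_val i).
  have /(fintype.subsetP sD) := enum_valP i; rewrite inE => /andP[/ne nB cB].
  exact: ffun_onto_set.
pose u (i : 'I_M) := widen_ord (ltnW ltD) i.
apply/existsP; exists [ffun i => sval (cid (ex (u i)))].
apply/forallP => i; apply/forallP => j; apply/implyP => ij.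
rewrite !ffunE; do 2![case: cid => ? /= ->].
have neij : enum_val (u i) != enum_val (u j).
  by apply: contra ij => /eqP/enum_val_inj/(congr1 val)/= /val_inj ->.
have dj := dD _ _ (enum_valP (u i)) (enum_valP (u j)) neij.
have inBB k : enum_val (u k) \in BB.
  by have /(fintype.subsetP sD) := enum_valP (u k); rewrite inE => /andP[].
have := jn (enum_val (u i)); rewrite inBB => /forallP/(_ (enum_val (u j))).
by rewrite inBB setI_eq0 dj.
Qed.

Section GraphEvents.
Variables (R : realType) (n : nat) (p : R).
Hypotheses (p_ge0 : 0 <= p) (p_le1 : p <= 1).
Local Notation P := (@gnp_prob R n p).

Lemma depends_on_joined (S T : {set 'I_n}) :
  depends_on (cross_edges S T) (fun G => joined G S T).
Proof.
move=> G H GH; rewrite !joinedE; congr negb.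
apply/pred0P/pred0P => h e /=; have := h e;
  rewrite /=; case: (boolP (e \in cross_edges S T)) => //= eE; by rewrite GH.
Qed.

Lemma prob_not_joined (S T : {set 'I_n}) : [disjoint S & T] ->
  P (fun G => ~~ joined G S T) = (1 - p) ^+ (#|S| * #|T|).
Proof.
move=> d; rewrite -card_cross_edges // -gnp_prob_no_edge ?cross_edges_pairs //.
by apply: eq_gnp_prob => G; rewrite joinedE negbK.
Qed.

Lemma prob_joined (S T : {set 'I_n}) : [disjoint S & T] ->
  P (fun G => joined G S T) = 1 - (1 - p) ^+ (#|S| * #|T|).
Proof. by move=> d; rewrite -prob_not_joined // gnp_probC opprB addrC subrK. Qed.

Lemma card_ltn_pairs M : #|[pred ij : 'I_M * 'I_M | (ij.1 < ij.2)%N]| = 'C(M, 2).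
Proof.
rewrite -sum1_card -bin2_sum big_mkord.
(* The pairs are counted by their larger coordinate j, which has j smaller partners. *)
rewrite (eq_bigl (fun ij : 'I_M * 'I_M => predT ij.2 && (ij.1 < ij.2)%N)) //.
rewrite -(pair_big_dep predT (fun i j : 'I_M => (i < j)%N) (fun _ _ => 1%N)) /=.
rewrite (exchange_big_dep predT) //=; apply: eq_bigr => j _.
by rewrite -(big_ord_widen M (fun=> 1%N) (ltnW (ltn_ord j))) sum1_card card_ord.
Qed.

Lemma prob_all_joined (M s : nat) (S : 'I_M -> {set 'I_n}) :
  (forall i j, i != j -> [disjoint S i & S j]) ->
  (forall i, (#|S i| <= s)%N) ->
  P (fun G => [forall ij : 'I_M * 'I_M, (ij.1 < ij.2)%N ==>
                 joined G (S ij.1) (S ij.2)])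
    <= (1 - (1 - p) ^+ (s * s)) ^+ 'C(M, 2).
Proof.
move=> dj cS.
have ne (ij : 'I_M * 'I_M) : (ij.1 < ij.2)%N -> ij.1 != ij.2.
  by rewrite neq_ltn => ->.
rewrite (@gnp_prob_forall_indep R n p _ _
  (fun ij : 'I_M * 'I_M => cross_edges (S ij.1) (S ij.2))); last first.
- by move=> ij _; exact: depends_on_joined.
- move=> [i j] [k l] ij kl ne'; apply: cross_edges_disjoint => //.
  have {}ij : (i < j)%N := ij; have {}kl : (k < l)%N := kl.
  by apply/eqP => -[E1 E2]; move: ij kl; rewrite E1 E2; lia.
rewrite -card_ltn_pairs -prodr_const; apply: ler_prod => ij ltij.
rewrite gnp_prob_ge0 //= prob_joined ?dj ?ne // lerD2l lerN2.
by apply: ler_wiXn2l; rewrite ?subr_ge0 ?gerBl // leq_mul.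
Qed.

(** Union bound over the n ^ (s M) families, each handled by independence of the joinings. *)
Lemma prob_joined_family (s M : nat) :
  P (fun G => [exists F : {ffun 'I_M -> {ffun 'I_s -> 'I_n}}, joined_family G F])
    <= n%:R ^+ (s * M) * (1 - (1 - p) ^+ (s * s)) ^+ 'C(M, 2).
Proof.
have q01 : 0 <= 1 - (1 - p) ^+ (s * s).
  by rewrite subr_ge0 exprn_ile1 ?subr_ge0 ?gerBl.
apply: (@le_trans _ _ (\sum_(F : {ffun 'I_M -> {ffun 'I_s -> 'I_n}})
    P (fun G => joined_family G F))).
  apply: le_trans (gnp_prob_exists p_ge0 p_le1 predT _).
  exact: le_gnp_prob.
apply: (@le_trans _ _ (\sum_(F : {ffun 'I_M -> {ffun 'I_s -> 'I_n}})
    (1 - (1 - p) ^+ (s * s)) ^+ 'C(M, 2))); last first.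
  by rewrite sumr_const !card_ffun !card_ord -[leLHS]mulr_natl 2!natrX -exprM.
apply: ler_sum => F _; pose S i := (F i @: finset.setT)%SET.
have [/forallP dj|ndj] := boolP [forall i, forall j, (i != j) ==> [disjoint S i & S j]].
  have {}dj i j : i != j -> [disjoint S i & S j].
    by move=> ij; have /forallP/(_ j) := dj i; rewrite ij.
  apply: le_trans (prob_all_joined dj (s := s) _).
    apply: le_gnp_prob => // G /forallP FG; apply/forallP => -[i j] /=.
    apply/implyP => ij; have /forallP/(_ j) := FG i.
    by rewrite neq_ltn ij => /andP[].
  move=> i; apply: leq_trans (leq_imset_card _ _) _.
  by rewrite cardsT card_ord.
(* If two of the sets meet, the event is empty. *)
rewrite /gnp_prob big_pred0 ?exprn_ge0 // => G; apply: contraNF ndj => /forallP FG.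
apply/forallP => i; apply/forallP => j; apply/implyP => ij.
by have /forallP/(_ j) := FG i; rewrite ij => /andP[].
Qed.

(** Different [z] involve disjoint pairs of edges, and both edges at [z] are present with
    probability p ^ 2. *)
Lemma prob_no_common_neighbour (x y : 'I_n) (Z : {set 'I_n}) :
  x != y -> x \notin Z -> y \notin Z ->
  P (fun G => [forall z, (z \in Z) ==> ~~ (adj G x z && adj G y z)])
    = (1 - p ^+ 2) ^+ #|Z|.
Proof.
move=> xy xZ yZ.
have zx z : z \in Z -> (x != z) && (y != z).
  by move=> zZ; apply/andP; split; [apply: contraNneq xZ|apply: contraNneq yZ] => ->.
rewrite (@gnp_prob_forall_indep R n p _ _
  (fun z => [set [set x; z]; [set y; z]]%SET)); last first.
- move=> z zZ G H GH; rewrite /adj !GH // !inE eqxx ?orbT //.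
- move=> z z' /zx/andP[xz yz] /zx/andP[xz' yz'] zz'.
  apply/pred0P => e /=; apply/negP; rewrite !inE.
  move=> /andP[/orP[]/eqP-> /orP[]/eqP/set2_eq[] [E1 E2]]; subst;
  by rewrite ?eqxx in xy xz yz xz' yz' zz'.
rewrite -prodr_const; apply: eq_bigr => z /zx/andP[xz yz].
rewrite gnp_probC; congr (1 - _).
have <- : #|[set [set x; z]; [set y; z]]%SET| = 2%N.
  rewrite cards2; suff -> : ([set x; z]%SET != [set y; z]%SET) by [].
  by apply/eqP => /set2_eq[] [E1 E2]; subst; rewrite ?eqxx in xy xz yz.
rewrite -gnp_prob_all_edges //; last first.
  by rewrite finset.subUset !finset.sub1set !inE !cards2 xz yz.
by apply: eq_gnp_prob => G; rewrite finset.subUset !finset.sub1set.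
Qed.

(** Fix a root [x] in [S]; disconnection forces some [y] to have no common neighbour with [x] among
    the other vertices of [S]. A union bound over [y] concludes. *)
Lemma prob_disconnected (S : {set 'I_n}) : S != finset.set0 ->
  P (fun G => ~~ connected_graph S (induced_edges G S))
    <= #|S|%:R * (1 - p ^+ 2) ^+ (#|S| - 2).
Proof.
move=> /set0Pn[x xS].
pose Z y := (S :\: [set x; y])%SET.
have c01 : 0 <= 1 - p ^+ 2 by rewrite subr_ge0 exprn_ile1.
apply: (@le_trans _ _ (\sum_(y in (S :\ x)%SET)
   P (fun G => [forall z, (z \in Z y) ==> ~~ (adj G x z && adj G y z)]))).
  apply: le_trans (gnp_prob_exists p_ge0 p_le1 (mem (S :\ x)%SET) _).
  apply: le_gnp_prob => // G nc; apply/existsP.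
  have [y yP|none] := pickP (fun y => (y \in (S :\ x)%SET) &&
    [forall z, (z \in Z y) ==> ~~ (adj G x z && adj G y z)]).
    by exists y.
  exfalso; move/negP: nc; apply; apply: (connected_via_common_neighbours xS).
  move=> y yS yx; have := none y; rewrite !inE yx yS /= => /negbT.
  rewrite negb_forall => /existsP[z]; rewrite negb_imply negbK.
  by rewrite finset.in_setD => /andP[/andP[_ zS] /andP[xz yz]]; exists z.
apply: (@le_trans _ _ (\sum_(y in (S :\ x)%SET) (1 - p ^+ 2) ^+ (#|S| - 2))).
  apply: ler_sum => y; rewrite !inE => /andP[yx yS].
  rewrite prob_no_common_neighbour ?inE ?eqxx ?orbT //; last by rewrite eq_sym.
  rewrite /Z finset.cardsD (finset.setIidPr _) ?finset.cards2 1?eq_sym ?yx //.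
  by rewrite finset.subUset !finset.sub1set xS.
rewrite sumr_const -[leLHS]mulr_natl ler_wpM2r ?exprn_ge0 // ler_nat.
by rewrite subset_leq_card // finset.subsetDl.
Qed.

End GraphEvents.

(** * Lower bound *)

Section LowerBound.
Variables (R : realType) (p beta : R).
Hypotheses (p_gt0 : 0 < p) (p_lt1 : p < 1).
Hypotheses (beta_gt0 : 0 < beta) (betaE : 1 - p = expR (- beta)).

Let p_ge0 : 0 <= p. Proof. exact: ltW. Qed.
Let p_le1 : p <= 1. Proof. exact: ltW. Qed.

Lemma block_subproof (n s : nat) (i : 'I_(n %/ s)) (j : 'I_s) : (i * s + j < n)%N.
Proof.
have := ltn_ord i; have := ltn_ord j; have := leq_trunc_div n s => *; nia.
Qed.

Definition block (n s : nat) (i : 'I_(n %/ s)) : {set 'I_n} :=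
  [set Ordinal (block_subproof i j) | j : 'I_s]%SET.

Lemma card_block n s (i : 'I_(n %/ s)) : #|block i| = s.
Proof.
rewrite card_imset ?card_ord // => j k /(congr1 val)/= /addnI; exact: val_inj.
Qed.

Lemma disjoint_block n s (i j : 'I_(n %/ s)) : i != j -> [disjoint block i & block j].
Proof.
move=> ij; apply/pred0P => x /=; apply/negP => /andP[/imsetP[k _ ->] /imsetP[l _]].
move=> /(congr1 val)/= E; move/eqP: ij; apply; apply: val_inj => /=.
have := ltn_ord k; have := ltn_ord l => *; nia.
Qed.

Lemma expected_defects (n s : nat) : (0 < s)%N ->
  \sum_(G : sgraph 'I_n) gnp_mass p G *
    ((\sum_(i < n %/ s) ~~ connected_graph (block i) (induced_edges G (block i))
     + \sum_(ij : 'I_(n %/ s) * 'I_(n %/ s) | (ij.1 < ij.2)%N)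
         ~~ joined G (block ij.1) (block ij.2))%N)%:R
  <= (n %/ s)%:R * (s%:R * (1 - p ^+ 2) ^+ (s - 2)
                    + (n %/ s)%:R * (1 - p) ^+ (s * s)).
Proof.
move=> s0; pose m := (n %/ s)%N.
rewrite (eq_bigr (fun G : sgraph 'I_n =>
  \sum_(i < m) gnp_mass p G *
     (~~ connected_graph (block i) (induced_edges G (block i)))%:R +
  \sum_(ij : 'I_m * 'I_m | (ij.1 < ij.2)%N)
     gnp_mass p G * (~~ joined G (block ij.1) (block ij.2))%:R)); last first.
  by move=> G _; rewrite natrD !natr_sum mulrDr !big_distrr.
rewrite big_split /= exchange_big /= [X in _ + X]exchange_big /= mulrDr lerD //.
  rewrite -[X in X%:R * _](card_ord m) -sumr_const big_distrl /=.
  apply: ler_sum => i _; rewrite mul1r gnp_expectation_indicator.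
  apply: le_trans (prob_disconnected p_ge0 p_le1 _) _; rewrite ?card_block //.
  by rewrite -cards_eq0 card_block -lt0n.
(* The ordered pairs with i < j are bounded crudely by all m ^ 2 pairs. *)
apply: (@le_trans _ _ (\sum_(ij : 'I_m * 'I_m) (1 - p) ^+ (s * s))); last first.
  by rewrite sumr_const card_prod card_ord -[leLHS]mulr_natl natrM mulrA.
rewrite [leLHS]big_mkcond; apply: ler_sum => -[i j] _ /=; case: ifP => [ij|_].
  rewrite gnp_expectation_indicator prob_not_joined ?card_block //.
  by apply: disjoint_block; rewrite neq_ltn ij.
by rewrite exprn_ge0 // subr_ge0.
Qed.

(** With a = - ln c, the product c ^ s * exp (a s) is 1 and exp (a s) >= (a s) ^ 2 / 2, which bounds
    s ^ 2 * c ^ s. *)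
Lemma geometric_decay (c : R) : 0 < c -> c < 1 ->
  exists2 C : R, 0 < C & forall s : nat, s%:R * (s%:R * c ^+ (s - 2)) <= C.
Proof.
move=> c0 c1; pose a := - ln c; have a0 : 0 < a by rewrite oppr_gt0 ln_lt0 // c0.
exists (2 / (a ^+ 2 * c ^+ 2)) => [|s].
  by rewrite divr_gt0 // mulr_gt0 // exprn_gt0.
have c2 : 0 < c ^+ 2 by rewrite exprn_gt0.
(* An equality for s >= 2; below, the truncated exponent is 0 and c ^ 2 <= c ^ s. *)
have cs : c ^+ (s - 2) * c ^+ 2 <= c ^+ s.
  by rewrite -exprD; apply: ler_wiXn2l; [exact: ltW|exact: ltW|lia].
have ec : c ^+ s * expR (a * s%:R) = 1.
  rewrite expRM_natr -exprMn /a expRN lnK ?posrE // divff ?expr1n //.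
  by rewrite gt_eqF.
have e2 : (a * s%:R) ^+ 2 / 2 <= expR (a * s%:R).
  have := @expR_ge1Dxn R (a * s%:R) 1 (mulr_ge0 (ltW a0) (ler0n _ _)).
  by rewrite -[2`!]/2%N; lra.
rewrite ler_pdivlMr ?mulr_gt0 ?exprn_gt0 //.
have cs0 : 0 < c ^+ s by rewrite exprn_gt0.
have : c ^+ s * ((a * s%:R) ^+ 2 / 2) <= 1 by rewrite -[leRHS]ec ler_wpM2l // ltW.
have : a ^+ 2 * s%:R ^+ 2 * (c ^+ (s - 2) * c ^+ 2) <= a ^+ 2 * s%:R ^+ 2 * c ^+ s.
  by rewrite ler_wpM2l // mulr_ge0 // sqr_ge0.
by nra.
Qed.

(** Markov's inequality for the number of defects: fewer than (1 - theta) m branch sets means at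
    least theta m defects. The constant depends on [p] only. *)
Lemma prob_hadwiger_small : exists2 C : R, 0 < C &
  forall (n : nat) (K theta : R), 0 < K -> n%:R = expR (beta * K ^+ 2) ->
    0 < theta -> let m := (n %/ (Num.truncn K).+1)%N in (0 < m)%N ->
  gnp_prob p (fun G : sgraph 'I_n => (hadwiger G)%:R < (1 - theta) * m%:R)
    <= C / (theta * K).
Proof.
have [||C C0 HC] := @geometric_decay (1 - p ^+ 2).
- by rewrite subr_gt0 expr_lt1.
- by rewrite gtrBl exprn_gt0.
exists (C + 1) => [|n K theta K0 nE th0 m m0]; first by rewrite addr_gt0.
set s := (Num.truncn K).+1 in m m0 *.
have Ks : K < s%:R by have /andP[] := truncn_itv (ltW K0).
have s0 : 0 < s%:R :> R by rewrite ltr0n.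
have mR0 : 0 < m%:R :> R by rewrite ltr0n.
have ms : m%:R * s%:R <= n%:R :> R by rewrite -natrM ler_nat leq_trunc_div.
set Pr := gnp_prob _ _.
have Pr0 : 0 <= Pr by exact: gnp_prob_ge0.
(* Here s > K is used: q ^ (s ^ 2) <= q ^ (K ^ 2) = 1 / n. *)
have qs : (1 - p) ^+ (s * s) * n%:R <= 1.
  rewrite betaE -expRM_natl nE -expRD -[leRHS]expR0 ler_expR natrM.
  rewrite mulrN addrC subr_le0 [leRHS]mulrC ler_pM2l //.
  by rewrite expr2 ler_pM // ltW.
have q0 : 0 <= (1 - p) ^+ (s * s) by rewrite exprn_ge0 // subr_ge0.
(* After multiplication by s, the expected defects per block split into at most C, by
   [geometric_decay], and at most 1, by m s <= n and [qs]. *)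
have key : theta * m%:R * Pr <= m%:R * ((C + 1) / s%:R).
  apply: (@le_trans _ _ (m%:R * (s%:R * (1 - p ^+ 2) ^+ (s - 2)
                    + m%:R * (1 - p) ^+ (s * s)))); last first.
    rewrite ler_wpM2l ?ler0n // ler_pdivlMr // mulrDl lerD //.
      by rewrite mulrC HC.
    by rewrite mulrAC mulrC; apply: le_trans qs; rewrite ler_wpM2l.
  apply: le_trans (expected_defects n (ltn0Sn _)).
  apply: le_trans (gnp_markov p_ge0 p_le1 (theta * m%:R) _) => [|G]; last first.
    exact: ler0n.
  rewrite ler_wpM2l ?mulr_ge0 ?(ltW th0) ?(ltW mR0) //.
  apply: le_gnp_prob => // G hG.
  have := @hadwiger_ge_delete _ m (@block n s) G (@disjoint_block n s).
  by rewrite -(ler_nat R) natrD; lra.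
rewrite ler_pdivlMr ?mulr_gt0 //.
have : theta * Pr <= (C + 1) / s%:R.
  by rewrite -(ler_pM2l mR0) mulrA [_ * theta]mulrC.
rewrite ler_pdivlMr // => h; apply: le_trans h.
by rewrite mulrA [Pr * _]mulrC ler_wpM2l ?(ltW Ks) // mulr_ge0 // ltW.
Qed.

End LowerBound.

(** * Upper bound *)

Lemma one_subX_le_expR (R : realType) (x : R) (N : nat) :
  x <= 1 -> (1 - x) ^+ N <= expR (- (x * N%:R)).
Proof.
move=> x1; rewrite -mulNr expRM_natr lerXn2r ?nnegrE ?subr_ge0 ?expR_ge0 //.
exact: expR_ge1Dx.
Qed.

Lemma natr_bin2 (R : realType) (M : nat) :
  2 * 'C(M, 2)%:R = M%:R * (M%:R - 1) :> R.
Proof.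
have := mul_bin_diag M 1; rewrite bin1 -natrM => <-.
by case: M => [|M]; rewrite ?mul0n ?mul0r //= natrM -natr1 addrK.
Qed.

Section UpperBound.
Variables (R : realType) (p beta : R).
Hypotheses (p_gt0 : 0 < p) (p_lt1 : p < 1).
Hypotheses (beta_gt0 : 0 < beta) (betaE : 1 - p = expR (- beta)).
Let p_ge0 : 0 <= p. Proof. exact: ltW. Qed.
Let p_le1 : p <= 1. Proof. exact: ltW. Qed.

(* Each of the M sets contributes a factor at most
   n^s = exp(beta K^2 s) to the count and q^(s^2) (M - 1) / 2 to the exponent. *)
Lemma prob_joined_family_le (n s M : nat) (K : R) :
  n%:R = expR (beta * K ^+ 2) -> (0 < M)%N -> 0 <= K ->
  beta * K ^+ 2 * s%:R + K <= expR (- (beta * s%:R ^+ 2)) * (M%:R - 1) / 2 ->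
  gnp_prob p (fun G : sgraph 'I_n =>
    [exists F : {ffun 'I_M -> {ffun 'I_s -> 'I_n}}, joined_family G F])
  <= expR (- K).
Proof.
move=> nE M0 K0 h; apply: le_trans (prob_joined_family n p_ge0 p_le1 s M) _.
have -> : (1 - p) ^+ (s * s) = expR (- (beta * s%:R ^+ 2)).
  by rewrite betaE -expRM_natr natrM mulNr expr2.
set Q := expR _ in h *.
have Q1 : Q <= 1.
  by rewrite -[leRHS]expR0 ler_expR oppr_le0 mulr_ge0 ?sqr_ge0 // ltW.
have M1 : 1 <= M%:R :> R by rewrite ler1n.
apply: (@le_trans _ _ (expR (beta * K ^+ 2 * (s * M)%:R) *
                       expR (- (Q * 'C(M, 2)%:R)))).
  by rewrite ler_pM ?exprn_ge0 ?subr_ge0 ?nE ?expRM_natr ?one_subX_le_expR.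
rewrite -expRD ler_expR natrM.
have -> : 'C(M, 2)%:R = M%:R * (M%:R - 1) / 2 :> R by rewrite -natr_bin2; lra.
(* The exponent is M times a quantity that [h] bounds by - K, and M >= 1. *)
apply: (@le_trans _ _ (M%:R * - K)); last first.
  by rewrite mulrN lerN2 ler_peMl.
have -> : beta * K ^+ 2 * (s%:R * M%:R) - Q * (M%:R * (M%:R - 1) / 2) =
  M%:R * (beta * K ^+ 2 * s%:R - Q * (M%:R - 1) / 2) by ring.
by rewrite ler_wpM2l // lerBlDr; lra.
Qed.

Lemma prob_frac_hadwiger_large (d : R) : 0 < d -> exists K0 : R,
  forall (n : nat) (K : R), K0 <= K -> n%:R = expR (beta * K ^+ 2) ->
  gnp_prob p (fun G : sgraph 'I_n =>
    ~~ (frac_hadwiger G <= (1 + d) * (n%:R / K))) <= expR (- K).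
Proof.
(* [a] is the ratio of the size threshold to K. As a < 1, the gap [g] is positive and q ^ (s ^ 2) n
   >= exp (g K ^ 2). *)
move=> d0; pose a := (1 + d / 2)^-1; pose g := beta * (1 - a ^+ 2).
have d2 : 0 < 1 + d / 2 by lra.
have a0 : 0 < a by rewrite invr_gt0.
have a1 : a < 1 by rewrite invf_lt1 //; lra.
have g0 : 0 < g by rewrite mulr_gt0 // subr_gt0 expr_lt1 // ltW.
have gd0 : 0 < g ^+ 3 * d by rewrite mulr_gt0 // exprn_gt0.
(* The summand 1 gives K >= 1; the fraction makes the K ^ 6 term of [e3] dominate in [QM]. *)
exists (1 + 12 * (4 + 2 * beta) / (g ^+ 3 * d)) => n K HK nE.
have K1 : 1 <= K.
  apply: le_trans HK; rewrite lerDl divr_ge0 ?(ltW gd0) //.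
  by rewrite mulr_ge0 // addr_ge0 // mulr_ge0 // ltW.
have K0 : 0 < K by lra.
have K2 : 0 < K ^+ 2 by rewrite exprn_gt0.
have n0 : 0 < n%:R :> R by rewrite nE expR_gt0.
(* [M] is chosen so that s M costs at most (d / 2) n / K. *)
pose s := Num.truncn (a * K); pose M := Num.truncn (d / 2 * n%:R / K ^+ 2).
have /andP[sle slt] := truncn_itv (ltW (mulr_gt0 a0 K0)).
have /andP[Mle Mlt] : (M%:R <= d / 2 * n%:R / K ^+ 2 < M.+1%:R).
  by apply: truncn_itv; rewrite divr_ge0 ?mulr_ge0 ?(ltW n0) ?(ltW K2) //; lra.
rewrite -/s in sle slt.
have sK : s%:R <= K by apply: le_trans sle _; rewrite ger_pMl // ltW.
set Q := expR (- (beta * s%:R ^+ 2)).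
have Q0 : 0 < Q by exact: expR_gt0.
have Q1 : Q <= 1.
  by rewrite -[leRHS]expR0 ler_expR oppr_le0 mulr_ge0 ?sqr_ge0 // ltW.
have Qn : expR (g * K ^+ 2) <= Q * n%:R.
  rewrite nE -expRD ler_expR /g.
  have : s%:R ^+ 2 <= (a * K) ^+ 2.
    by rewrite ler_pXn2r ?nnegrE // ltW // mulr_gt0.
  rewrite -(ler_pM2l beta_gt0) exprMn; lra.
(* The bound exp x >= x ^ 3 / 6 suffices: divided by K ^ 2, it still leaves K ^ 4 against the
   required K ^ 3. *)
have e3 : g ^+ 3 * K ^+ 6 / 6 <= Q * n%:R.
  apply: le_trans Qn.
  have := @expR_ge1Dxn R (g * K ^+ 2) 2 (mulr_ge0 (ltW g0) (ltW K2)).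
  by rewrite -[3`!]/6%N exprMn -exprM; lra.
(* The loss of 2 pays for passing from M + 1 to M - 1, as Q <= 1. With s <= K and K >= 1 this covers
   2 (beta K ^ 2 s + K). *)
have QM : K ^+ 3 * (4 + 2 * beta) - 2 <= Q * (M%:R - 1).
  have : Q * (d / 2 * n%:R / K ^+ 2) <= Q * M.+1%:R by rewrite ler_pM2l // ltW.
  rewrite -[M.+1%:R]natr1; suff : K ^+ 3 * (4 + 2 * beta) <= Q * (d / 2 * n%:R / K ^+ 2) by lra.
  rewrite !mulrA ler_pdivlMr //.
  apply: (@le_trans _ _ (g ^+ 3 * K ^+ 6 / 6 * (d / 2))); last first.
    by rewrite [leRHS](_ : _ = Q * n%:R * (d / 2)); [rewrite ler_pM2r //; lra|ring].
  have HK' : 12 * (4 + 2 * beta) <= K * (g ^+ 3 * d).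
    by rewrite -ler_pdivrMr //; lra.
  have K5 : 0 <= K ^+ 5 by rewrite exprn_ge0 // ltW.
  have := ler_wpM2l K5 HK'.
  have -> : K ^+ 5 * (K * (g ^+ 3 * d)) = g ^+ 3 * K ^+ 6 * d by ring.
  have -> : K ^+ 3 * (4 + 2 * beta) * K ^+ 2 = K ^+ 5 * (4 + 2 * beta) by ring.
  lra.
have K3 : K <= K ^+ 3 by rewrite exprS ler_peMr ?exprn_ege1 // ltW.
have bKs : beta * K ^+ 2 * s%:R <= beta * K ^+ 3.
  by rewrite [K ^+ 3]exprSr mulrA ler_pM2l // mulr_gt0.
have M0 : (0 < M)%N.
  rewrite lt0n; apply: contraTN isT => /eqP M0; rewrite M0 in QM.
  have : 0 < K ^+ 3 * beta by rewrite mulr_gt0 // exprn_gt0.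
  lra.
apply: le_trans (prob_joined_family_le nE M0 (ltW K0) (s := s) _); last first.
  rewrite -/Q ler_pdivlMr //.
  have : 1 <= K ^+ 3 by rewrite exprn_ege1.
  lra.
apply: le_gnp_prob => // G; apply: contraR => /(@frac_hadwiger_le R) h.
apply: le_trans h _; rewrite card_ord.
have h1 : n%:R / s.+1%:R <= (1 + d / 2) * (n%:R / K).
  rewrite mulrCA ler_pM2l // ler_pdivlMr // -[1 + d / 2]invrK -/a.
  rewrite mulrC ler_pdivrMr ?ltr0n // ler_pdivlMl //; exact: ltW.
have h2 : s%:R * M%:R <= d / 2 * (n%:R / K).
  apply: (@le_trans _ _ (K * (d / 2 * n%:R / K ^+ 2))); first exact: ler_pM.
  by rewrite le_eqVlt; apply/orP; left; apply/eqP; field; rewrite gt_eqF.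
apply: le_trans (lerD h1 h2) _; lra.
Qed.

End UpperBound.

(** * Asymptotics *)

Section Asymptotics.
Variables (R : realType) (p b : R).
Hypotheses (p_gt0 : 0 < p) (p_lt1 : p < 1) (b_def : b = 1 / (1 - p)).

Let p_ge0 : 0 <= p. Proof. exact: ltW. Qed.
Let p_le1 : p <= 1. Proof. exact: ltW. Qed.
Let K (n : nat) : R := Num.sqrt (log_base b n%:R).

Lemma ln_bE : ln b = - ln (1 - p).
Proof. by rewrite b_def div1r lnV // posrE subr_gt0. Qed.

Lemma ln_b_gt0 : 0 < ln b.
Proof. by rewrite ln_bE oppr_gt0 ln_lt0 // subr_gt0 p_lt1 gtrBl. Qed.

Lemma one_sub_pE : 1 - p = expR (- ln b).
Proof. by rewrite ln_bE opprK lnK // posrE subr_gt0. Qed.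

Lemma natr_expR_sqrt_log n : (0 < n)%N -> n%:R = expR (ln b * K n ^+ 2).
Proof.
move=> n0; rewrite /K /log_base sqr_sqrtr; last first.
  by rewrite divr_ge0 ?(ltW ln_b_gt0) // ln_ge0 // ler1n.
by rewrite mulrC divfK ?(gt_eqF ln_b_gt0) // lnK // posrE ltr0n.
Qed.

Lemma near_sqrt_log_ge (C : R) : \forall n \near \oo%classic, C <= K n.
Proof.
have := nbhs_infty_ger (expR (ln b * C ^+ 2)); apply: filterS => n h.
have n0 : 0 < n%:R :> R by apply: lt_le_trans h; exact: expR_gt0.
(* [C] may be negative, and the square root of C ^ 2 is its absolute value. *)
apply: (@le_trans _ _ `|C|); first exact: ler_norm.
rewrite -sqrtr_sqr /K ler_wsqrtr // /log_base ler_pdivlMr ?ln_b_gt0 //.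
by rewrite mulrC -ler_expR lnK // posrE.
Qed.

(** Rounding [x] up and the number m of blocks down replaces m x by at most (m + 1) (x + 1). The
    excess m + x + 1 is absorbed by the slack d m x / 2 >= 2 m. *)
Lemma blocks_enough (n : nat) (x d : R) :
  0 < d -> d < 1 -> 4 / d <= x -> 2 * x ^+ 2 <= n%:R ->
  (1 - d) * (n%:R / x) <= (1 - d / 2) * (n %/ (Num.truncn x).+1)%:R.
Proof.
move=> d0 d1 xd nx; set s := (Num.truncn x).+1; set m := (n %/ s)%N.
have xd' : 4 <= x * d by rewrite -ler_pdivrMr.
have x0 : 0 < x by apply: lt_le_trans xd; rewrite divr_gt0.
have x1 : 1 <= x by nra.
have sx : s%:R <= x + 1.
  by have /andP[h _] := truncn_itv (ltW x0); rewrite /s -natr1 lerD2r.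
have nms : n%:R <= (m%:R + 1) * s%:R :> R.
  by rewrite natr1 -natrM ler_nat ltnW // ltn_ceil.
have m0 : 0 <= m%:R :> R by exact: ler0n.
have nm : n%:R <= (m%:R + 1) * (x + 1).
  by apply: le_trans nms _; rewrite ler_wpM2l //; lra.
rewrite mulrA ler_pdivrMr //.
(* Indeed (m + 1) (x + 1) >= n >= 2 x ^ 2 >= x (x + 1). *)
have mx : x <= m%:R + 1.
  have x10 : 0 < x + 1 by lra.
  rewrite -(ler_pM2r x10); apply: le_trans nm; apply: le_trans nx; nra.
have h : (1 - d) * n%:R <= (1 - d) * ((m%:R + 1) * (x + 1)).
  by rewrite ler_wpM2l //; lra.
apply: le_trans h _.
nra.
Qed.

Lemma as_hadwiger_ge (d : R) : 0 < d ->
  almost_surely p (fun n (G : sgraph 'I_n) =>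
    (1 - d) * (n%:R / K n) <= (hadwiger G)%:R).
Proof.
move=> d0; have [d1|d1] := leP 1 d.
  (* For d >= 1 the left side is at most 0. *)
  apply: almost_surely_near => // eps eps0; near=> n.
  rewrite /gnp_prob big_pred0 ?ltW // => G; apply/negbTE; rewrite negbK.
  apply: (@le_trans _ _ 0) => //; rewrite mulr_le0_ge0 ?subr_le0 //.
  by rewrite divr_ge0 // sqrtr_ge0.
have [C C0 HC] := prob_hadwiger_small p_gt0 p_lt1 ln_b_gt0 one_sub_pE.
apply: almost_surely_near => // eps eps0; near=> n.
have n0 : (0 < n)%N by near: n; exact: nbhs_infty_gt.
have K1 : 1 <= K n by near: n; exact: near_sqrt_log_ge.
have K0 : 0 < K n by lra.
have Kd : 4 / d <= K n by near: n; exact: near_sqrt_log_ge.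
have Kb : 2 / ln b <= K n by near: n; exact: near_sqrt_log_ge.
have Ke : C / (d / 2 * eps) <= K n by near: n; exact: near_sqrt_log_ge.
have nE := natr_expR_sqrt_log n0.
(* From exp x >= x ^ 2 / 2 with x = ln b * K ^ 2, since ln b * K >= 2. *)
have n2 : 2 * K n ^+ 2 <= n%:R.
  have K2 : 0 <= K n ^+ 2 by rewrite sqr_ge0.
  have := @expR_ge1Dxn R (ln b * K n ^+ 2) 1 (mulr_ge0 (ltW ln_b_gt0) K2).
  rewrite -nE -[2`!]/2%N exprMn.
  have : 2 <= ln b * K n by rewrite mulrC -ler_pdivrMr ?ln_b_gt0.
  move=> h; have : 2 ^+ 2 <= (ln b * K n) ^+ 2.
    by rewrite ler_pXn2r // nnegrE; lra.
  rewrite exprMn => h2.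
  have := ler_wpM2l K2 h2; lra.
have bl := blocks_enough d0 d1 Kd n2.
have d20 : 0 < d / 2 by lra.
have m0 : (0 < n %/ (Num.truncn (K n)).+1)%N.
  rewrite -(ltr0n R); have : 0 < (1 - d) * (n%:R / K n).
    by rewrite mulr_gt0 ?subr_gt0 // divr_gt0 // ltr0n.
  by move=> h; have := lt_le_trans h bl; rewrite pmulr_rgt0 //; lra.
apply: (@le_trans _ _ (C / (d / 2 * K n))); last first.
  rewrite ler_pdivrMr ?mulr_gt0 //; move: Ke; rewrite ler_pdivrMr ?mulr_gt0 //.
  lra.
(* Half of [d] pays for the deleted blocks, the other half for the rounding in [blocks_enough]. *)
apply: le_trans (HC n (K n) (d / 2) K0 nE d20 m0).
apply: le_gnp_prob => // G; rewrite -ltNge => h; exact: lt_le_trans h bl.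
Unshelve. all: by end_near.
Qed.

Lemma as_frac_hadwiger_le (d : R) : 0 < d ->
  almost_surely p (fun n (G : sgraph 'I_n) =>
    frac_hadwiger G <= (1 + d) * (n%:R / K n)).
Proof.
move=> d0; have [K0 HK0] :=
  prob_frac_hadwiger_large p_gt0 p_lt1 ln_b_gt0 one_sub_pE d0.
apply: almost_surely_near => // eps eps0; near=> n.
have n0 : (0 < n)%N by near: n; exact: nbhs_infty_gt.
have KK0 : K0 <= K n by near: n; exact: near_sqrt_log_ge.
have Ke : - ln eps <= K n by near: n; exact: near_sqrt_log_ge.
apply: le_trans (HK0 n (K n) KK0 (natr_expR_sqrt_log n0)) _.
by rewrite -[leRHS](lnK eps0) ler_expR lerNl.
Unshelve. all: by end_near.
Qed.

End Asymptotics.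

Theorem theorem4 (R : realType) (p b : R)
    (p_gt0 : 0 < p) (p_lt1 : p < 1) (b_def : b = 1 / (1 - p)) :
  (forall delta : R, 0 < delta ->
     almost_surely p (fun (n : nat) (G : sgraph 'I_n) =>
       (1 - delta) * (n%:R / Num.sqrt (log_base b n%:R))
         <= frac_hadwiger G
         <= (1 + delta) * (n%:R / Num.sqrt (log_base b n%:R))))
  /\
  (forall delta : R, 0 < delta ->
     almost_surely p (fun (n : nat) (G : sgraph 'I_n) =>
       (1 - delta) * (hadwiger G)%:R
         <= frac_hadwiger G
         <= (1 + delta) * (hadwiger G)%:R)).
Proof.
have p_ge0 := ltW p_gt0; have p_le1 := ltW p_lt1.
split=> d d0.
  have := almost_surelyI p_ge0 p_le1 (as_hadwiger_ge p_gt0 p_lt1 b_def d0)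
    (as_frac_hadwiger_le p_gt0 p_lt1 b_def d0).
  apply: almost_surelyS => //; near=> n => G /andP[h1 ->]; rewrite andbT.
  exact: le_trans h1 (hadwiger_le_frac R G).
(* e solves (1 + d) * (1 - e) = 1 + e *)
pose e := d / (2 + d); have d2 : 0 < 2 + d by lra.
have e0 : 0 < e by rewrite divr_gt0.
have := almost_surelyI p_ge0 p_le1 (as_hadwiger_ge p_gt0 p_lt1 b_def e0)
  (as_frac_hadwiger_le p_gt0 p_lt1 b_def e0).
apply: almost_surelyS => //; near=> n => G /andP[h1 h2]; apply/andP; split.
  (* This side holds for every graph. *)
  by apply: le_trans (hadwiger_le_frac R G); rewrite ler_piMl // gerBl ltW.
apply: le_trans h2 _.
have -> : 1 + e = (1 + d) * (1 - e) by rewrite /e; field; rewrite gt_eqF.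
by rewrite -mulrA ler_pM2l //; lra.
Unshelve. all: by end_near.
Qed.
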